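(* Let $U$ and $V$ be real normed spaces. A linear operator $S:U\to V$ is $st$-bounded if and only if it is $st$-continuous; that is, $\mathcal{B}_{st}(U,V)\cap\mathcal{L}(U,V)=\mathcal{C}_{st}(U,V)$.
   Context: The natural density of $K\subseteq\mathbb{N}$ is $\delta(K)=\lim_{n\to\infty}\frac1n|\{k\le n: k\in K\}|$ when the limit exists. A sequence $(x_n)$ in a normed space is statistically bounded if there is $M>0$ with $\delta(\{n:\|x_n\|>M\})=0$, and statistically convergent to $x$ if $\delta(\{k:\|x_k-x\|\ge\varepsilon\})=0$ for every $\varepsilon>0$. $\mathcal{L}(U,V)$ is the set of linear operators $U\to V$. A (not necessarily linear) operator $S:U\to V$ is $st$-bounded if it maps statistically bounded sequences in $U$ (termwise) to statistically bounded sequences in $V$; $\mathcal{B}_{st}(U,V)$ is the set of these. A linear operator $S:U\to V$ is $st$-continuous if, whenever $(x_n)$ converges statistically to the zero vector in $U$, $(S(x_n))$ converges statistically to the zero vector in $V$; $\mathcal{C}_{st}(U,V)$ is the set of these. *)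

(* Defs.v *)
From HB Require Import structures.
From mathcomp Require Import all_boot all_order all_algebra.
From mathcomp Require Import all_classical all_reals all_analysis.
Import Order.TTheory GRing.Theory Num.Theory.
Import numFieldNormedType.Exports.

Set Implicit Arguments.
Unset Strict Implicit.
Unset Printing Implicit Defensive.

Local Open Scope classical_set_scope.
Local Open Scope ring_scope.

(* [has_density K d] means that the natural density of [K] exists and equals
   [d].  Indices start at 0 here, so that the count ranges over 0, ..., n;
   whether index 0 is counted does not affect the limit, nor does the value
   of the quotient at n = 0. *)
Definition has_density (R : realType) (K : set nat) (d : R) : Prop :=
  (#|[set k : 'I_n.+1 | (k : nat) \in K]%SET|%:R / n%:R : R) @[n --> \oo] --> d.

Definition stat_bounded (R : realType) (U : normedModType R)
    (x : nat -> U) : Prop :=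
  exists M : R, 0 < M /\ has_density [set n | M < `|x n|] (0 : R).

Definition stat_converges (R : realType) (U : normedModType R)
    (x : nat -> U) (l : U) : Prop :=
  forall e : R, 0 < e -> has_density [set k | e <= `|x k - l|] (0 : R).

Definition st_bounded (R : realType) (U V : normedModType R)
    (S : U -> V) : Prop :=
  forall x : nat -> U, stat_bounded x -> stat_bounded (fun n => S (x n)).

Definition st_continuous (R : realType) (U V : normedModType R)
    (S : U -> V) : Prop :=
  forall x : nat -> U,
    stat_converges x 0 -> stat_converges (fun n => S (x n)) 0.

Definition Lin (R : realType) (U V : normedModType R) : set (U -> V) :=
  [set S | linear S].

Definition Bst (R : realType) (U V : normedModType R) : set (U -> V) :=
  [set S | st_bounded S].

Definition Cst (R : realType) (U V : normedModType R) : set (U -> V) :=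
  [set S | linear S /\ st_continuous S].

Arguments Lin {R} U V _.
Arguments Bst {R} U V _.
Arguments Cst {R} U V _.

(* Main.v *)
(* Both conditions are equivalent to the existence of a constant [C] with
   [|S u| <= C |u|] for all [u].  Such a bound transfers either property by
   monotonicity of density-zero sets.  If there is no such bound, rescaling
   gives vectors with [|x n| <= 1 / (n + 1)] and [n < |S (x n)|]: this single
   sequence is bounded and null, while [S (x n)] exceeds any threshold at all
   but finitely many indices. *)
Require Import Defs.
From mathcomp Require Import all_boot all_order all_algebra.
From mathcomp Require Import all_classical all_reals all_analysis.
Import Order.TTheory GRing.Theory Num.Theory.
Import numFieldNormedType.Exports.
Local Open Scope classical_set_scope.
Local Open Scope ring_scope.

Lemma has_density0_sub {R : realType} {A B : set nat} :
  A `<=` B -> has_density B (0 : R) -> has_density A (0 : R).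
Proof.
move=> AB; rewrite /has_density => B0.
apply: (squeeze_cvgr _ (cvg_cst (0 : R)) B0); near=> n.
rewrite divr_ge0 ?ler0n//= ler_pM2r; last first.
  by rewrite invr_gt0 ltr0n; near: n; exact: nbhs_infty_gt.
rewrite ler_nat; apply/subset_leq_card/fintype.subsetP => k.
by rewrite !finset.inE => /set_mem/AB/mem_set.
Unshelve. all: by end_near. Qed.

Lemma has_density0_setU {R : realType} {A B : set nat} :
  has_density A (0 : R) -> has_density B (0 : R) ->
  has_density (A `|` B) (0 : R).
Proof.
rewrite /has_density => A0 B0.
have := cvgD A0 B0; rewrite addr0 => /(_ _) AB0.
apply: (squeeze_cvgr _ (cvg_cst (0 : R)) AB0); near=> n.
rewrite divr_ge0 ?ler0n//= fctE -mulrDl ler_pM2r; last first.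
  by rewrite invr_gt0 ltr0n; near: n; exact: nbhs_infty_gt.
rewrite -natrD ler_nat; apply: leq_trans (leq_card_setU _ _).
apply/subset_leq_card/fintype.subsetP => k.
by rewrite !finset.inE => /set_mem[] /mem_set ->; rewrite ?orbT.
Unshelve. all: by end_near. Qed.

(** At most [N] indices are ever counted, so the quotient is at most [N / n], which tends to 0. *)
Lemma has_density0_ltn (R : realType) (N : nat) :
  has_density [set k | (k < N)%N] (0 : R).
Proof.
rewrite /has_density.
have N0 : N%:R / n%:R @[n --> \oo] --> (0 : R).
  rewrite -(mulr0 (N%:R : R)); apply: cvgMl_tmp.
  apply/gtr0_cvgV0; last exact: cvgr_idn.
  by near=> n; rewrite ltr0n; near: n; exact: nbhs_infty_gt.
apply: (squeeze_cvgr _ (cvg_cst (0 : R)) N0); near=> n.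
rewrite divr_ge0 ?ler0n//= ler_pM2r; last first.
  by rewrite invr_gt0 ltr0n; near: n; exact: nbhs_infty_gt.
(* [N] may lie on either side of [n.+1], so the counted ordinals are replaced by their values, a
   duplicate-free list contained in [iota 0 N]. *)
rewrite ler_nat cardE -(size_map val) -[leqRHS](size_iota 0).
apply: uniq_leq_size; first by rewrite (map_inj_uniq val_inj) enum_uniq.
move=> _ /mapP[k + ->]; rewrite mem_enum finset.inE => /set_mem /= kN.
by rewrite mem_iota.
Unshelve. all: by end_near. Qed.

(** All of ['I_n.+1] is counted, so for [0 < n] the quotient is [n.+1 / n], hence at least 1. *)
Lemma not_has_density0_setT (R : realType) : ~ has_density setT (0 : R).
Proof.
rewrite /has_density => T0.
suff : (1 : R) <= 0 by rewrite ler10.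
apply: (ler_cvg_to (cvg_cst (1 : R)) T0); near=> n.
have n0 : (0 < n)%N by near: n; exact: nbhs_infty_gt.
rewrite ler_pdivlMr ?ltr0n// mul1r ler_nat.
rewrite (_ : [set _ | _]%SET = finset.setT) ?cardsT ?card_ord//.
by apply/finset.setP => k; rewrite !finset.inE in_setT.
Unshelve. all: by end_near. Qed.

(** Adding the indices below [N], a set of density zero, to [A] gives all of [nat]. *)
Lemma not_has_density0_cofinite {R : realType} {A : set nat} (N : nat) :
  (forall n, (N <= n)%N -> A n) -> ~ has_density A (0 : R).
Proof.
move=> NA A0; apply: (not_has_density0_setT R).
have AN0 := has_density0_setU A0 (has_density0_ltn R N).
apply: (has_density0_sub _ AN0) => n _.
by case: (ltnP n N) => [|/NA]; [right|left].
Qed.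

Definition linearly_bounded {R : realType} {U V : normedModType R}
    (S : U -> V) : Prop :=
  exists2 C : R, 0 < C & forall u, `|S u| <= C * `|u|.

Section LinearlyBounded.
Context {R : realType} {U V : normedModType R} {S : U -> V}.

Lemma linearly_bounded_st_bounded : linearly_bounded S -> st_bounded S.
Proof.
move=> [C C0 SC] x [M [M0 xM]]; exists (C * M); split; first exact: mulr_gt0.
apply: (has_density0_sub _ xM) => n /= CM.
by rewrite -(ltr_pM2l C0); exact: lt_le_trans (SC _).
Qed.

Lemma linearly_bounded_st_continuous : linearly_bounded S -> st_continuous S.
Proof.
move=> [C C0 SC] x x0 e e0.
apply: (has_density0_sub _ (x0 (e / C) (divr_gt0 e0 C0))) => n /=.
rewrite !subr0 ler_pdivrMr// mulrC => /le_trans; apply.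
exact: SC.
Qed.

Lemma not_linearly_bounded_seq : linear S -> ~ linearly_bounded S ->
  exists x : nat -> U, forall n, `|x n| <= n.+1%:R^-1 /\ n%:R < `|S (x n)|.
Proof.
move=> linS unbS.
have scalS : scalable S by exact: scalable_linear.
suff xP n : exists v, `|v| <= n.+1%:R^-1 /\ n%:R < `|S v|.
  by have [x xP'] := choice xP; exists x.
have c0 : 0 < n.+1%:R :> R by rewrite ltr0n.
(* The constant is a square because [n.+1] is used twice: dividing [u] by [n.+1 * |u|] spends one
   factor on making the vector small, and the other keeps its image large. *)
have [u Su] : exists u, n.+1%:R * n.+1%:R * `|u| < `|S u|.
  apply: contrapT => /forallNP noU; apply: unbS.
  exists (n.+1%:R * n.+1%:R); first exact: mulr_gt0.
  by move=> u; rewrite leNgt; apply/negP/noU.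
(* If [u] were 0, both sides of the strict inequality [Su] would vanish, since [S 0 = 0] by scaling
   with 0. *)
have u0 : 0 < `|u|.
  rewrite normr_gt0; apply/eqP => u0; move: Su.
  by rewrite u0 -(scale0r 0) scalS scale0r !scale0r !normr0 mulr0 ltxx.
have cu0 : 0 < n.+1%:R * `|u| by exact: mulr_gt0.
exists ((n.+1%:R * `|u|)^-1 *: u); rewrite scalS !normrZ normfV (gtr0_norm cu0).
split; first by rewrite invfM -mulrA mulVf ?mulr1// gt_eqF.
rewrite mulrC ltr_pdivlMr//; apply: le_lt_trans Su.
by rewrite -mulrA ler_pM2r// ler_nat.
Qed.

Lemma not_has_density0_unbounded {x : nat -> V} (M : R) :
  (forall n, n%:R < `|x n|) -> ~ has_density [set n | M < `|x n|] (0 : R).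
Proof.
(* The Archimedean bound is taken of [|M|] because [M] may be negative. *)
move=> xn; apply: (not_has_density0_cofinite (Num.bound `|M|)) => n Mn /=.
apply: le_lt_trans (xn n); apply: le_trans (ler_norm M) _.
apply: le_trans (ltW (archi_boundP (normr_ge0 M))) _.
by rewrite ler_nat.
Qed.

Lemma st_bounded_linearly_bounded :
  linear S -> st_bounded S -> linearly_bounded S.
Proof.
move=> linS bS; apply: contrapT => /(not_linearly_bounded_seq linS)[x xP].
have [|M [_]] := bS x.
  (* The threshold 1 is never exceeded, as [1 / (n + 1) <= 1]; the exceptional set is empty, which
     is the case [N = 0] of [has_density0_ltn]. *)
  exists 1; split=> //.
  apply: (has_density0_sub _ (has_density0_ltn R 0)) => n /=.
  by rewrite ltNge (le_trans (xP n).1)// invf_le1 ?ler1n ?ltr0n//.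
by apply: not_has_density0_unbounded => n; have [] := xP n.
Qed.

Lemma st_continuous_linearly_bounded :
  linear S -> st_continuous S -> linearly_bounded S.
Proof.
move=> linS cS; apply: contrapT => /(not_linearly_bounded_seq linS)[x xP].
have x0 : stat_converges x 0.
  move=> e e0.
  (* From [e <= |x n| <= 1 / (n + 1)] follows [n + 1 <= 1 / e], so only finitely many indices are
     exceptional. *)
  apply: (has_density0_sub _ (has_density0_ltn R (Num.bound e^-1))) => n /=.
  rewrite subr0 => /le_trans/(_ (xP n).1) en.
  rewrite -(ltr_nat R); apply: le_lt_trans (archi_boundP _); last first.
    by rewrite invr_ge0 ltW.
  apply: (@le_trans _ _ n.+1%:R); first by rewrite ler_nat.
  by rewrite -[leLHS]invrK lef_pV2 ?posrE ?invr_gt0.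
have Sx n : n%:R < `|S (x n)| by have [] := xP n.
(* Tolerance 1 suffices for the contradiction: statistical convergence controls the indices with
   [1 <= |S (x n)|], which include those with strict inequality. *)
case: (not_has_density0_unbounded 1 Sx).
apply: (has_density0_sub _ (cS x x0 1 ltr01)) => n /=.
by rewrite subr0; exact: ltW.
Qed.

End LinearlyBounded.

Theorem theorem3p4 (R : realType) (U V : normedModType R) :
  (forall S : U -> V, linear S -> (st_bounded S <-> st_continuous S)) /\
  Bst U V `&` Lin U V = Cst U V.
Proof.
have equiv (S : U -> V) : linear S -> (st_bounded S <-> st_continuous S).
  move=> linS; split.
    by move/(st_bounded_linearly_bounded linS)/linearly_bounded_st_continuous.
  by move/(st_continuous_linearly_bounded linS)/linearly_bounded_st_bounded.
split=> //; apply/seteqP; split=> S /=.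
  by move=> [bS linS]; split=> //; exact/(equiv S linS).
by move=> [linS cS]; split=> //; exact/(equiv S linS).
Qed.
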